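(* For all integers $n>m\geq 1$, the group $\mathrm{Diff}^\omega_+(\mathbb{R})$ of orientation-preserving real-analytic diffeomorphisms of $\mathbb{R}$ contains a subgroup isomorphic to the Baumslag–Solitar group $\mathrm{BS}(m,n)=\langle a,b : ab^ma^{-1}=b^n\rangle$. The same holds for the groups $\mathrm{Homeo}_+(S^1)$ and $\mathrm{Homeo}_+([0,1])$ of orientation-preserving homeomorphisms of the circle and of the interval. *)

(* Defs.v *)
From Stdlib Require Import Reals List.
From Coquelicot Require Import Coquelicot.
Import ListNotations.
Open Scope R_scope.

(* A letter is (gen, inv): gen = true for a, false for b; inv = true for the
   inverse of the generator. A word is a list of letters, read as the product
   x1 x2 ... xk. *)
Definition letter := (bool * bool)%type.
Definition word := list letter.

Definition letter_inv (l : letter) : letter := (fst l, negb (snd l)).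

Definition la : letter := (true, false).
Definition la' : letter := (true, true).
Definition lb : letter := (false, false).
Definition lb' : letter := (false, true).

Definition bs_relator (m n : nat) : word :=
  [la] ++ repeat lb m ++ [la'] ++ repeat lb' n.

(* The congruence on words defining BS(m,n) = < a, b | a b^m a^{-1} = b^n >:
   the equivalence relation generated by deleting (or, by symmetry,
   inserting) a trivial pair x x^{-1} or a copy of the relator anywhere. *)
Inductive bs_equiv (m n : nat) : word -> word -> Prop :=
| bs_refl w : bs_equiv m n w w
| bs_sym u v : bs_equiv m n u v -> bs_equiv m n v u
| bs_trans u v w : bs_equiv m n u v -> bs_equiv m n v w -> bs_equiv m n u w
| bs_free u v x : bs_equiv m n (u ++ x :: letter_inv x :: v) (u ++ v)
| bs_rel u v : bs_equiv m n (u ++ bs_relator m n ++ v) (u ++ v).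

Definition letter_eval {X : Type} (f finv g ginv : X -> X) (l : letter)
  : X -> X :=
  match l with
  | (true, false) => f
  | (true, true) => finv
  | (false, false) => g
  | (false, true) => ginv
  end.

Fixpoint word_eval {X : Type} (f finv g ginv : X -> X) (w : word) : X -> X :=
  match w with
  | nil => fun x => x
  | l :: w' => fun x => letter_eval f finv g ginv l (word_eval f finv g ginv w' x)
  end.

(* Given two elements (with their inverses) of a group of maps on the domain
   D (elements equal iff equal on D), the assignment a |-> f, b |-> g defines
   an isomorphism of BS(m,n) onto the subgroup <f,g>: a word evaluates to the
   identity iff it is trivial in BS(m,n) (=> injective, <= well defined). *)
Definition embeds_BS {X : Type} (D : X -> Prop) (m n : nat)
  (f finv g ginv : X -> X) : Prop :=
  forall w : word,
    (forall x, D x -> word_eval f finv g ginv w x = x) <-> bs_equiv m n w nil.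

Definition real_analytic (f : R -> R) : Prop :=
  forall x0 : R, exists r : R, 0 < r /\ exists a : nat -> R,
    forall x, Rabs (x - x0) < r -> is_pseries a (x - x0) (f x).

Definition is_diff_omega_plus (f finv : R -> R) : Prop :=
  (forall x, f (finv x) = x) /\ (forall x, finv (f x) = x) /\
  real_analytic f /\ real_analytic finv /\
  (forall x y, x < y -> f x < f y).

Definition unitI (x : R) : Prop := 0 <= x <= 1.

Definition continuous_on_I (f : R -> R) : Prop :=
  forall x, unitI x -> forall eps, 0 < eps -> exists delta, 0 < delta /\
    forall y, unitI y -> Rabs (y - x) < delta -> Rabs (f y - f x) < eps.

Definition is_homeo_plus_I (f finv : R -> R) : Prop :=
  (forall x, unitI x -> unitI (f x)) /\ (forall x, unitI x -> unitI (finv x)) /\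
  (forall x, unitI x -> f (finv x) = x) /\ (forall x, unitI x -> finv (f x) = x) /\
  continuous_on_I f /\ continuous_on_I finv /\
  (forall x y, unitI x -> unitI y -> x < y -> f x < f y).

Definition pt := (R * R)%type.

Definition on_circle (p : pt) : Prop := fst p ^ 2 + snd p ^ 2 = 1.

Definition dist2 (p q : pt) : R :=
  sqrt ((fst p - fst q) ^ 2 + (snd p - snd q) ^ 2).

Definition continuous_on_circle (f : pt -> pt) : Prop :=
  forall p, on_circle p -> forall eps, 0 < eps -> exists delta, 0 < delta /\
    forall q, on_circle q -> dist2 q p < delta -> dist2 (f q) (f p) < eps.

(* signed area: > 0 iff (p, q, r) is in counterclockwise cyclic order *)
Definition orient (p q r : pt) : R :=
  (fst q - fst p) * (snd r - snd p) - (snd q - snd p) * (fst r - fst p).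

(* orientation preserving = preserves the (counterclockwise) cyclic order *)
Definition is_homeo_plus_S1 (f finv : pt -> pt) : Prop :=
  (forall p, on_circle p -> on_circle (f p)) /\
  (forall p, on_circle p -> on_circle (finv p)) /\
  (forall p, on_circle p -> f (finv p) = p) /\
  (forall p, on_circle p -> finv (f p) = p) /\
  continuous_on_circle f /\ continuous_on_circle finv /\
  (forall p q r, on_circle p -> on_circle q -> on_circle r ->
     0 < orient p q r -> 0 < orient (f p) (f q) (f r)).

(* Main.v *)
Require Import Defs.
From Stdlib Require Import Reals List.
From Stdlib Require Import Lra Lia ZArith Setoid Morphisms Classical.
From Coquelicot Require Import Coquelicot.
Import ListNotations.
Open Scope R_scope.

(** The generator [b] acts as [x |-> x + 1] and [a] as an analytic
    diffeomorphism with [a (x + m) = a x + n], so [a b^m a^-1 = b^n].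
    The map [a] is the lift of a hyperbolic projective map of [R / Z], rescaled
    by [m] in the source and by [n] in the target, and so contracting that it
    sends the complement of the 1/8-neighbourhood of [m Z] into the
    1/8-neighbourhood of [1/2 + n Z]; then [a^-1] sends the complement of the
    latter into the former.  A word without a subword [a b^(m q) a^-1] or
    [a^-1 b^(n q) a] therefore plays ping-pong: it moves [1/4] near
    [Z] or [1/2 + Z] unless it is a power of [b].  The analyticity of [a] and of
    [a^-1] comes from the closed form of the derivative, the inverse of an
    affine function of a cosine.  Conjugation by the arctangent and by the
    stereographic projection carries the action to the interval and to the
    circle. *)

(** * Words in BS(m, n) *)

Section Words.
Variables m n : nat.
Local Notation "u ~~ v" := (bs_equiv m n u v) (at level 70).

(** Each generating move already takes place inside arbitrary words [u] and [v], which absorb the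
    context. The instances below turn this into rewriting inside words. *)
Lemma bs_equiv_context p s u v : u ~~ v -> p ++ u ++ s ~~ p ++ v ++ s.
Proof.
induction 1 as [w|u v _ IH|u v w _ IH1 _ IH2|u v x|u v].
- apply bs_refl.
- now apply bs_sym.
- now apply bs_trans with (p ++ v ++ s).
- replace (p ++ (u ++ x :: letter_inv x :: v) ++ s)
    with ((p ++ u) ++ x :: letter_inv x :: (v ++ s))
    by now rewrite <- !app_assoc.
  replace (p ++ (u ++ v) ++ s) with ((p ++ u) ++ (v ++ s))
    by now rewrite <- !app_assoc.
  apply bs_free.
- replace (p ++ (u ++ bs_relator m n ++ v) ++ s)
    with ((p ++ u) ++ bs_relator m n ++ (v ++ s))
    by now rewrite <- !app_assoc.
  replace (p ++ (u ++ v) ++ s) with ((p ++ u) ++ (v ++ s))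
    by now rewrite <- !app_assoc.
  apply bs_rel.
Qed.

#[local] Instance bs_equiv_Equivalence : Equivalence (bs_equiv m n).
Proof.
split; [exact (bs_refl m n) | exact (bs_sym m n) | exact (bs_trans m n)].
Qed.

#[local] Instance app_bs_equiv :
  Proper (bs_equiv m n ==> bs_equiv m n ==> bs_equiv m n) (@app letter).
Proof.
intros u u' Hu v v' Hv.
transitivity (u' ++ v).
- exact (bs_equiv_context [] v u u' Hu).
- generalize (bs_equiv_context u' [] v v' Hv); now rewrite !app_nil_r.
Qed.

#[local] Instance cons_bs_equiv x :
  Proper (bs_equiv m n ==> bs_equiv m n) (@cons letter x).
Proof. intros u v H; exact (app_bs_equiv [x] [x] (bs_refl m n [x]) u v H). Qed.

Lemma cancel_letter x w : x :: letter_inv x :: w ~~ w.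
Proof. exact (bs_free m n [] w x). Qed.

Lemma cancel_letter_inv x w : letter_inv x :: x :: w ~~ w.
Proof.
destruct x as [g i]; generalize (cancel_letter (g, negb i) w).
unfold letter_inv; cbn [fst snd]; now rewrite Bool.negb_involutive.
Qed.

Definition bpow (k : Z) : word :=
  if Z.leb 0 k then repeat lb (Z.to_nat k) else repeat lb' (Z.to_nat (- k)).

Lemma bpow_nonneg k : bpow (Z.of_nat k) = repeat lb k.
Proof.
unfold bpow; destruct (Z.leb_spec 0 (Z.of_nat k)); [|lia].
now rewrite Nat2Z.id.
Qed.

Lemma bpow_nonpos k : bpow (- Z.of_nat k) = repeat lb' k.
Proof.
unfold bpow; destruct (Z.leb_spec 0 (- Z.of_nat k)).
- now replace k with 0%nat by lia.
- now rewrite Z.opp_involutive, Nat2Z.id.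
Qed.

Lemma Z_nat_cases k :
  (exists j, k = Z.of_nat j) \/ (exists j, k = - Z.of_nat (S j))%Z.
Proof.
destruct (Z.le_gt_cases 0 k).
- left; exists (Z.to_nat k); lia.
- right; exists (pred (Z.to_nat (- k))); lia.
Qed.

Lemma bpow_succ k : lb :: bpow k ~~ bpow (k + 1).
Proof.
destruct (Z_nat_cases k) as [[j ->]|[j ->]].
- replace (Z.of_nat j + 1)%Z with (Z.of_nat (S j)) by lia.
  now rewrite !bpow_nonneg.
- replace (- Z.of_nat (S j) + 1)%Z with (- Z.of_nat j)%Z by lia.
  rewrite !bpow_nonpos; exact (cancel_letter lb _).
Qed.

Lemma bpow_pred k : lb' :: bpow k ~~ bpow (k - 1).
Proof.
rewrite <- (Z.sub_add 1 k) at 1.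
rewrite <- bpow_succ; exact (cancel_letter lb' _).
Qed.

Lemma bpow_add j k : bpow j ++ bpow k ~~ bpow (j + k).
Proof.
destruct (Z_nat_cases j) as [[i ->]|[i ->]].
- rewrite bpow_nonneg; induction i as [|i IH]; [reflexivity|].
  cbn [repeat app]; rewrite IH, bpow_succ.
  now replace (Z.of_nat i + k + 1)%Z with (Z.of_nat (S i) + k)%Z by lia.
- rewrite bpow_nonpos; induction (S i) as [|i' IH]; [reflexivity|].
  cbn [repeat app]; rewrite IH, bpow_pred.
  now replace (- Z.of_nat i' + k - 1)%Z with (- Z.of_nat (S i') + k)%Z by lia.
Qed.

Lemma bpow_add_app j k w : bpow j ++ bpow k ++ w ~~ bpow (j + k) ++ w.
Proof. now rewrite app_assoc, bpow_add. Qed.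

(** Appending [b^n] to the relator cancels its tail [b^-n]. *)
Lemma relation_word : la :: bpow (Z.of_nat m) ++ [la'] ~~ bpow (Z.of_nat n).
Proof.
transitivity ((bs_relator m n ++ []) ++ bpow (Z.of_nat n)).
- unfold bs_relator; rewrite app_nil_r, <- !app_assoc; cbn [app].
  rewrite bpow_nonneg, <- bpow_nonpos, bpow_add.
  now rewrite Z.add_opp_diag_l.
- exact (app_bs_equiv _ _ (bs_rel m n [] []) _ _ (bs_refl m n _)).
Qed.

Lemma relation_word_inv : la' :: bpow (Z.of_nat n) ++ [la] ~~ bpow (Z.of_nat m).
Proof.
rewrite <- relation_word; cbn [app].
rewrite (cancel_letter la'), <- app_assoc; cbn [app].
now rewrite (cancel_letter la'), app_nil_r.
Qed.

(** Conjugation by [x] is multiplicative, so one relation gives all its powers. The letter [x] is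
    left general to serve both [a] and [a^-1]. *)
Lemma conj_bpow x p q :
  x :: bpow (Z.of_nat p) ++ [letter_inv x] ~~ bpow (Z.of_nat q) ->
  forall k, x :: bpow (Z.of_nat p * k) ++ [letter_inv x] ~~ bpow (Z.of_nat q * k).
Proof.
intros H.
assert (Hnat : forall j, x :: bpow (Z.of_nat p * Z.of_nat j) ++ [letter_inv x]
                 ~~ bpow (Z.of_nat q * Z.of_nat j)).
{ induction j as [|j IH].
  - rewrite !Z.mul_0_r; exact (cancel_letter x []).
  - replace (Z.of_nat p * Z.of_nat (S j))%Z
      with (Z.of_nat p + Z.of_nat p * Z.of_nat j)%Z by lia.
    replace (Z.of_nat q * Z.of_nat (S j))%Z
      with (Z.of_nat q + Z.of_nat q * Z.of_nat j)%Z by lia.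
    rewrite <- !bpow_add, <- H, <- IH, <- !app_assoc; cbn [app].
    rewrite <- !app_assoc; cbn [app].
    now rewrite cancel_letter_inv. }
intros k; destruct (Z_nat_cases k) as [[j ->]|[j ->]]; [apply Hnat|].
rewrite !Z.mul_opp_r.
generalize (Hnat (S j)); set (N := Z.of_nat (S j)); intros HN.
(* For a negative exponent, [b^(-q N) b^(q N)] is inserted in front; replacing its second factor by
   [x b^(p N) x^-1] cancels everything but [b^(-q N)]. *)
transitivity (bpow (- (Z.of_nat q * N)) ++ bpow (Z.of_nat q * N) ++
              x :: bpow (- (Z.of_nat p * N)) ++ [letter_inv x]).
{ rewrite bpow_add_app, Z.add_opp_diag_l; reflexivity. }
rewrite <- HN; cbn [app]; rewrite <- app_assoc; cbn [app].
rewrite cancel_letter_inv, bpow_add_app, Z.add_opp_diag_r.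
change (bpow 0 ++ [letter_inv x]) with [letter_inv x].
now rewrite cancel_letter, app_nil_r.
Qed.

(* The syllable [(e, k)] stands for [a b^k] if [e = false] and for [a^-1 b^k]
   if [e = true]. *)
Fixpoint syllables_word (l : list (bool * Z)) : word :=
  match l with
  | [] => []
  | (e, k) :: l' => (true, e) :: bpow k ++ syllables_word l'
  end.

(** Indices of the associated subgroups of the HNN extension: [a] conjugates [<b^m>] to [<b^n>], and
    [a^-1] conjugates [<b^n>] to [<b^m>]. *)
Definition edge_index (e : bool) : nat := if e then n else m.

(* No subword [a b^(m q) a^-1] or [a^-1 b^(n q) a]. *)
Inductive reduced : list (bool * Z) -> Prop :=
| reduced_nil : reduced []
| reduced_one e k : reduced [(e, k)]
| reduced_cons e k e' k' l :
    (e = e' \/ ~ (Z.of_nat (edge_index e) | k)%Z) ->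
    reduced ((e', k') :: l) -> reduced ((e, k) :: (e', k') :: l).

Lemma conj_edge e k :
  (true, e) :: bpow (Z.of_nat (edge_index e) * k) ++ [(true, negb e)]
    ~~ bpow (Z.of_nat (edge_index (negb e)) * k).
Proof.
destruct e; cbn [edge_index negb].
- exact (conj_bpow la' n m relation_word_inv k).
- exact (conj_bpow la m n relation_word k).
Qed.

(** Induction on the word, prepending one letter. A letter [b] or [b^-1] changes [k]. A letter [a]
    or [a^-1] opens a new syllable with exponent [k], unless it forms a pinch with the next
    syllable; then [conj_edge] turns the pinch into a power of [b] and the list loses a syllable. *)
Lemma reduced_form w :
  exists k l, reduced l /\ w ~~ bpow k ++ syllables_word l.
Proof.
induction w as [|[g e] w (k & l & Hl & Hw)].
- exists 0%Z, []; split; [constructor | reflexivity].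
- destruct g; [|destruct e].
  + destruct l as [|[e' k'] l].
    * exists 0%Z, [(e, k)]; split; [constructor | now rewrite Hw].
    * destruct (Bool.bool_dec e e') as [->|ne];
        [|destruct (Znumtheory.Zdivide_dec (Z.of_nat (edge_index e)) k)
           as [[q Hq]|nd]].
      -- exists 0%Z, ((e', k) :: (e', k') :: l); split; [|now rewrite Hw].
         now constructor; [left|].
      -- exists (Z.of_nat (edge_index (negb e)) * q + k')%Z, l; split.
         { inversion Hl; [constructor | assumption]. }
         rewrite Hw, <- bpow_add_app, <- conj_edge, Hq, Z.mul_comm.
         cbn [syllables_word app]; rewrite <- app_assoc; cbn [app].
         now replace (negb e) with e' by (destruct e, e'; easy).
      -- exists 0%Z, ((e, k) :: (e', k') :: l); split; [|now rewrite Hw].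
         now constructor; [right|].
  + exists (k - 1)%Z, l; split; [easy|].
    rewrite Hw, <- bpow_pred; reflexivity.
  + exists (k + 1)%Z, l; split; [easy|].
    rewrite Hw, <- bpow_succ; reflexivity.
Qed.
End Words.

(** * Ping-pong on the real line *)

Lemma word_eval_app {X} (f finv g ginv : X -> X) u v x :
  word_eval f finv g ginv (u ++ v) x =
  word_eval f finv g ginv u (word_eval f finv g ginv v x).
Proof. induction u as [|l u IH]; simpl; [easy | now rewrite IH]. Qed.

Section PingPong.
Variables (m n : nat) (f finv : R -> R).
Hypothesis f_finv : forall x, f (finv x) = x.
Hypothesis finv_f : forall x, finv (f x) = x.
Hypothesis f_shift : forall x, f (x + INR m) = f x + INR n.

Local Notation ev := (word_eval f finv (fun x => x + 1) (fun x => x - 1)).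

Lemma eval_repeat_lb k x : ev (repeat lb k) x = x + INR k.
Proof.
induction k as [|k IH]; [simpl; ring|].
rewrite S_INR; cbn [repeat word_eval letter_eval lb]; rewrite IH; ring.
Qed.

Lemma eval_repeat_lb' k x : ev (repeat lb' k) x = x - INR k.
Proof.
induction k as [|k IH]; [simpl; ring|].
rewrite S_INR; cbn [repeat word_eval letter_eval lb']; rewrite IH; ring.
Qed.

Lemma eval_bpow k x : ev (bpow k) x = x + IZR k.
Proof.
destruct (Z_nat_cases k) as [[j ->]|[j ->]].
- now rewrite bpow_nonneg, eval_repeat_lb, INR_IZR_INZ.
- rewrite bpow_nonpos, eval_repeat_lb', opp_IZR, INR_IZR_INZ; ring.
Qed.

Lemma eval_relator x : ev (bs_relator m n) x = x.
Proof.
unfold bs_relator; rewrite !word_eval_app, eval_repeat_lb', eval_repeat_lb.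
cbn [word_eval letter_eval la la'].
rewrite f_shift, f_finv; ring.
Qed.

Lemma eval_equiv u v : bs_equiv m n u v -> forall x, ev u x = ev v x.
Proof.
induction 1 as [w|u v _ IH|u v w _ IH1 _ IH2|u v l|u v]; intros x; auto.
- now rewrite IH1.
- rewrite !word_eval_app; f_equal.
  destruct l as [[] []]; cbn [word_eval letter_eval letter_inv fst snd negb];
    auto; ring.
- now rewrite !word_eval_app, eval_relator.
Qed.

(** The closed 1/8-neighbourhood of [c + p Z]. Any radius below 1/4 would keep the neighbourhoods of
    [0] and [1/2] modulo 1 apart and leave [1/4] outside both. *)
Definition near (p : nat) (c x : R) : Prop :=
  exists k : Z, Rabs (x - c - IZR k * INR p) <= 1 / 8.

(** The integer [k - (i - j) p] has absolute value at most 1/4, so it vanishes. Hence a power of [b]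
    outside [<b^p>] moves the neighbourhood off itself. *)
Lemma near_shift p c k x :
  near p c (x + IZR k) -> near p c x -> (Z.of_nat p | k)%Z.
Proof.
intros [i Hi] [j Hj]; exists (i - j)%Z.
assert (H : Rabs (IZR (k - (i - j) * Z.of_nat p)) < 1).
{ rewrite minus_IZR, mult_IZR, minus_IZR, <- INR_IZR_INZ.
  replace (IZR k - (IZR i - IZR j) * INR p) with
    ((x + IZR k - c - IZR i * INR p) - (x - c - IZR j * INR p)) by ring.
  apply Rabs_le_between in Hi; apply Rabs_le_between in Hj.
  apply Rabs_def1; lra. }
apply Rabs_def2 in H; destruct H as [H1 H2].
change (- (1)) with (IZR (-1)) in H2.
apply lt_IZR in H1; apply lt_IZR in H2; lia.
Qed.

(** Only residues modulo 1 matter, so the periods may differ: the integer [N] would lie between 1/4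
    and 3/4. *)
Lemma near_half p q k x : near p 0 x -> ~ near q (1 / 2) (x + IZR k).
Proof.
intros [i Hi] [j Hj].
set (N := (i * Z.of_nat p + k - j * Z.of_nat q)%Z).
assert (E : IZR N = IZR i * INR p + IZR k - IZR j * INR q)
  by (unfold N; now rewrite minus_IZR, plus_IZR, !mult_IZR, <- !INR_IZR_INZ).
apply Rabs_le_between in Hi; apply Rabs_le_between in Hj.
assert (H1 : 0 < IZR N) by lra.
assert (H2 : IZR N < 1) by lra.
apply lt_IZR in H1; apply lt_IZR in H2; lia.
Qed.

Lemma near_half' p q k x : near p (1 / 2) x -> ~ near q 0 (x + IZR k).
Proof.
intros H H'; apply (near_half q p (- k) _ H').
rewrite opp_IZR; now replace (x + IZR k + - IZR k) with x by ring.
Qed.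

(** With [quarter_not_near_half], this makes [1/4] a base point outside both regions, whatever power
    of [b] acts on it. *)
Lemma quarter_not_near0 p k : ~ near p 0 (1 / 4 + IZR k).
Proof.
intros [i Hi].
set (N := (k - i * Z.of_nat p)%Z).
assert (E : IZR N = IZR k - IZR i * INR p)
  by (unfold N; now rewrite minus_IZR, !mult_IZR, <- !INR_IZR_INZ).
apply Rabs_le_between in Hi.
assert (H1 : -1 < IZR N) by lra.
assert (H2 : IZR N < 0) by lra.
apply lt_IZR in H1; apply lt_IZR in H2; lia.
Qed.

Lemma quarter_not_near_half p k : ~ near p (1 / 2) (1 / 4 + IZR k).
Proof.
intros [i Hi].
set (N := (k - i * Z.of_nat p)%Z).
assert (E : IZR N = IZR k - IZR i * INR p)
  by (unfold N; now rewrite minus_IZR, !mult_IZR, <- !INR_IZR_INZ).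
apply Rabs_le_between in Hi.
assert (H1 : 0 < IZR N) by lra.
assert (H2 : IZR N < 1) by lra.
apply lt_IZR in H1; apply lt_IZR in H2; lia.
Qed.

Hypothesis f_contract : forall x, ~ near m 0 x -> near n (1 / 2) (f x).

Lemma finv_contract x : ~ near n (1 / 2) x -> near m 0 (finv x).
Proof.
intros H; destruct (Classical_Prop.classic (near m 0 (finv x))) as [|H']; auto.
now apply f_contract in H'; rewrite f_finv in H'.
Qed.

(** The letter [(true, e)] sends every point outside [target (negb e)] into [target e]. *)
Definition target (e : bool) : R -> Prop :=
  if e then near m 0 else near n (1 / 2).

(** Induction from the right end of the word: before [(true, e)] acts, the point must avoid
    [target (negb e)]. If the preceding letter to act was the same, the point lies in [target e] up
    to an integer translation, and [near_half] or [near_half'] applies. If it was the opposite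
    letter, the point was in [target (negb e)], and [b^k] has moved it out by [near_shift], as
    [edge_index e] does not divide [k]. *)
Lemma reduced_target r : reduced m n r ->
  match r with
  | [] => True
  | (e, _) :: _ => target e (ev (syllables_word r) (1 / 4))
  end.
Proof.
assert (Hstep : forall e k x, ~ target (negb e) (x + IZR k) ->
  target e (letter_eval f finv (fun x => x + 1) (fun x => x - 1) (true, e)
              (ev (bpow k) x))).
{ intros [] k x H; rewrite eval_bpow; [now apply finv_contract|].
  now apply f_contract. }
assert (Hcons : forall e k l,
  ~ target (negb e) (ev (syllables_word l) (1 / 4) + IZR k) ->
  target e (ev (syllables_word ((e, k) :: l)) (1 / 4))).
{ intros e k l H; cbn [syllables_word word_eval]; rewrite word_eval_app.
  now apply Hstep. }
induction 1 as [|e k|e k e' k' l Hk Hl IH]; [easy| |]; apply Hcons.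
- destruct e; [apply quarter_not_near_half | apply quarter_not_near0].
- revert IH; generalize (ev (syllables_word ((e', k') :: l)) (1 / 4)).
  intros y IH H.
  destruct Hk as [->|Hk].
  + destruct e'; [exact (near_half _ _ _ _ IH H)|].
    exact (near_half' _ _ _ _ IH H).
  + apply Hk; destruct e, e'; cbn [target negb edge_index] in *.
    * destruct (near_half _ _ _ _ IH H).
    * exact (near_shift _ _ _ _ H IH).
    * exact (near_shift _ _ _ _ H IH).
    * destruct (near_half' _ _ _ _ IH H).
Qed.

(** The point [1/4] alone detects triviality. If [b^k] times a reduced word fixes it, the reduced
    word sends [1/4] to [1/4 - k], which lies in neither target. So there are no syllables, and then
    [k = 0]. *)
Lemma pingpong_embeds_BS :
  embeds_BS (fun _ => True) m n f finv (fun x => x + 1) (fun x => x - 1).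
Proof.
intros w; split; [|intros H x _; now rewrite (eval_equiv _ _ H)].
intros H; specialize (H (1 / 4) I).
destruct (reduced_form m n w) as (k & l & Hl & Hw).
rewrite (eval_equiv _ _ Hw), word_eval_app, eval_bpow in H.
destruct l as [|[e k'] l].
- cbn [syllables_word word_eval] in H.
  assert (k = 0%Z) as -> by (apply eq_IZR; lra).
  exact Hw.
- apply reduced_target in Hl.
  assert (E : ev (syllables_word ((e, k') :: l)) (1 / 4) = 1 / 4 + IZR (- k))
    by (rewrite opp_IZR; lra).
  rewrite E in Hl; destruct e.
  + destruct (quarter_not_near0 _ _ Hl).
  + destruct (quarter_not_near_half _ _ Hl).
Qed.
End PingPong.

(** * Real-analytic functions *)

(** The series is in the increment [u], and the equality is a filter statement kept apart from the
    radius, so that closure proofs only intersect neighbourhoods of 0. *)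
Definition analytic_at (f : R -> R) (x0 : R) : Prop :=
  exists a : nat -> R, Rbar_lt 0 (CV_radius a) /\
    locally 0 (fun u => f (x0 + u) = PSeries a u).

Lemma locally_lt_CV_radius a : Rbar_lt 0 (CV_radius a) ->
  locally 0 (fun u => Rbar_lt (Rabs u) (CV_radius a)).
Proof.
intros H.
assert (Hr : exists r : posreal, Rbar_le r (CV_radius a)).
{ destruct (CV_radius a) as [r| |]; [|now exists (mkposreal 1 Rlt_0_1)|easy].
  exists (mkposreal r H); apply Rbar_le_refl. }
destruct Hr as [r Hr]; exists r; intros u Hu.
apply Rbar_lt_le_trans with (2 := Hr).
change (Rabs (u - 0) < r) in Hu; now rewrite Rminus_0_r in Hu.
Qed.

Lemma CV_radius_pos a r M : 0 < r -> (forall k, Rabs (a k * r ^ k) <= M) ->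
  Rbar_lt 0 (CV_radius a).
Proof.
intros Hr H; apply Rbar_lt_le_trans with (1 := Hr : Rbar_lt 0 r).
apply (proj1 (CV_radius_bounded a)); now exists M.
Qed.

Lemma analytic_real_analytic f :
  (forall x0, analytic_at f x0) -> real_analytic f.
Proof.
intros H x0; destruct (H x0) as (a & Ha & Hf).
destruct (filter_and _ _ (locally_lt_CV_radius a Ha) Hf) as [r Hr].
exists r; split; [apply cond_pos|]; exists a; intros x Hx.
assert (Hx' : Hierarchy.ball 0 r (x - x0)).
{ change (Rabs (x - x0 - 0) < r); now rewrite Rminus_0_r. }
destruct (Hr _ Hx') as [H1 H2].
replace x with (x0 + (x - x0)) at 2 by ring.
rewrite H2; now apply PSeries_correct, CV_radius_inside.
Qed.

Lemma analytic_at_ext f g x0 :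
  (forall x, f x = g x) -> analytic_at f x0 -> analytic_at g x0.
Proof.
intros E (a & Ha & Hf); exists a; split; [easy|].
revert Hf; apply filter_imp; intros u <-; now rewrite E.
Qed.

Definition PS_const (c : R) (k : nat) : R :=
  match k with O => c | S _ => 0 end.

Lemma CV_radius_const c : Rbar_lt 0 (CV_radius (PS_const c)).
Proof.
apply CV_radius_pos with 1 (Rabs c); [lra|]; intros [|k]; cbn [PS_const].
- now rewrite Rmult_1_r; right.
- rewrite Rmult_0_l, Rabs_R0; apply Rabs_pos.
Qed.

Lemma PSeries_const c : locally 0 (fun u => PSeries (PS_const c) u = c).
Proof.
generalize (locally_lt_CV_radius _ (CV_radius_const c)).
apply filter_imp; intros u Hu.
rewrite PSeries_decr_1 by now apply CV_radius_inside.
rewrite (PSeries_ext _ (fun _ => 0)) by easy.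
rewrite PSeries_const_0; cbn; ring.
Qed.

Lemma analytic_at_const c x0 : analytic_at (fun _ => c) x0.
Proof.
exists (PS_const c); split; [apply CV_radius_const|].
generalize (PSeries_const c); now apply filter_imp.
Qed.

(** Otherwise every [r] at which the terms are bounded is nonpositive, and the radius, their
    supremum, would be at most 0. *)
Lemma CV_radius_bound a : Rbar_lt 0 (CV_radius a) ->
  exists r M, 0 < r /\ forall k, Rabs (a k * r ^ k) <= M.
Proof.
intros H; apply NNPP; intros Hn.
apply (Rbar_lt_not_le _ _ H).
apply (proj2 (CV_radius_bounded a)); intros r [M HM].
destruct (Rle_lt_dec r 0) as [Hr|Hr]; [exact Hr|].
destruct Hn; now exists r, M.
Qed.

Lemma analytic_at_plus f g x0 : analytic_at f x0 -> analytic_at g x0 ->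
  analytic_at (fun x => f x + g x) x0.
Proof.
intros (a & Ha & Hf) (b & Hb & Hg); exists (PS_plus a b); split.
- apply Rbar_lt_le_trans with (2 := CV_radius_plus a b).
  now apply Rbar_min_case.
- generalize (filter_and _ _ (filter_and _ _ Hf Hg)
    (filter_and _ _ (locally_lt_CV_radius a Ha) (locally_lt_CV_radius b Hb))).
  apply filter_imp; intros u [[-> ->] [H1 H2]].
  now rewrite PSeries_plus by now apply CV_radius_inside.
Qed.

Lemma locally_0_pos (P : R -> Prop) : locally 0 P -> exists r, 0 < r /\ P r.
Proof.
intros [r Hr]; exists (r / 2); generalize (cond_pos r); intros Hp.
split; [lra|]; apply Hr; change (Rabs (r / 2 - 0) < r).
rewrite Rabs_pos_eq; lra.
Qed.

(** Both series converge absolutely at some [r > 0], hence so does the Cauchy product converge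
    there; its terms tend to 0 and are therefore bounded. *)
Lemma CV_radius_mult a b :
  Rbar_lt 0 (CV_radius a) -> Rbar_lt 0 (CV_radius b) ->
  Rbar_lt 0 (CV_radius (PS_mult a b)).
Proof.
intros Ha Hb.
destruct (locally_0_pos _ (filter_and _ _ (locally_lt_CV_radius a Ha)
  (locally_lt_CV_radius b Hb))) as (r & Hr & H1 & H2).
destruct (ex_pseries_mult a b r H1 H2) as [l Hl].
apply is_pseries_R in Hl.
assert (H : ex_series (fun k => PS_mult a b k * r ^ k)) by now exists l.
apply ex_series_lim_0 in H.
destruct (filterlim_bounded _ (ex_intro _ 0 H)) as [M HM].
now apply CV_radius_pos with r M.
Qed.

Lemma analytic_at_mult f g x0 : analytic_at f x0 -> analytic_at g x0 ->
  analytic_at (fun x => f x * g x) x0.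
Proof.
intros (a & Ha & Hf) (b & Hb & Hg); exists (PS_mult a b); split.
- now apply CV_radius_mult.
- generalize (filter_and _ _ (filter_and _ _ Hf Hg)
    (filter_and _ _ (locally_lt_CV_radius a Ha) (locally_lt_CV_radius b Hb))).
  apply filter_imp; intros u [[-> ->] [H1 H2]].
  now rewrite PSeries_mult.
Qed.

(* [PS_inv_upto a k] agrees up to index [k] with the formal inverse of [a]. *)
Fixpoint PS_inv_upto (a : nat -> R) (k : nat) : nat -> R :=
  match k with
  | O => fun _ => / a O
  | S k' => fun j =>
      if Nat.leb j k' then PS_inv_upto a k' j
      else - / a O * sum_f_R0 (fun i => PS_inv_upto a k' i * a (S k' - i)%nat) k'
  end.

Definition PS_inv (a : nat -> R) (k : nat) : R := PS_inv_upto a k k.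

Lemma PS_inv_upto_eq a k j : (j <= k)%nat -> PS_inv_upto a k j = PS_inv a j.
Proof.
induction 1 as [|k Hk IH]; [easy|]; cbn [PS_inv_upto].
now rewrite (proj2 (Nat.leb_le j k) Hk).
Qed.

Lemma PS_inv_succ a k :
  PS_inv a (S k) = - / a O * sum_f_R0 (fun i => PS_inv a i * a (S k - i)%nat) k.
Proof.
unfold PS_inv at 1; cbn [PS_inv_upto].
replace (Nat.leb (S k) k) with false by (symmetry; apply Nat.leb_gt; lia).
f_equal; apply sum_eq; intros i Hi; now rewrite PS_inv_upto_eq.
Qed.

Lemma PS_mult_inv a k : a O <> 0 -> PS_mult (PS_inv a) a k = PS_const 1 k.
Proof.
intros Ha; destruct k as [|k]; unfold PS_mult; cbn [PS_const].
- now apply Rinv_l.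
- rewrite tech5, Nat.sub_diag, PS_inv_succ; field; easy.
Qed.

(** In the recursion the powers of [C] combine to [C ^ S k], and the factor 2 absorbs the remaining
    sum [1 + 2 + ... + 2^k = 2^(k+1) - 1]. *)
Lemma PS_inv_bound a C : a O <> 0 -> 0 < C ->
  (forall k, Rabs (a (S k)) <= Rabs (a O) * C ^ S k) ->
  forall k, Rabs (PS_inv a k) <= / Rabs (a O) * (2 * C) ^ k.
Proof.
intros Ha HC H.
assert (Hpos : 0 < Rabs (a O)) by now apply Rabs_pos_lt.
assert (Hall : forall k j, (j <= k)%nat ->
  Rabs (PS_inv a j) <= / Rabs (a O) * (2 * C) ^ j);
  [|intros k; now apply (Hall k)].
induction k as [|k IH]; intros j Hj.
{ replace j with O by lia; unfold PS_inv; cbn [PS_inv_upto pow].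
  rewrite Rabs_inv; lra. }
destruct (Nat.eq_dec j (S k)) as [->|ne]; [|apply IH; lia].
rewrite PS_inv_succ, Rabs_mult, Rabs_Ropp, Rabs_inv.
apply Rmult_le_compat_l; [left; now apply Rinv_0_lt_compat|].
apply Rle_trans with (1 := Rsum_abs _ _).
apply Rle_trans with (sum_f_R0 (fun i => 2 ^ i * C ^ S k) k).
- apply sum_Rle; intros i Hi; rewrite Rabs_mult.
  apply Rle_trans with
    (/ Rabs (a O) * (2 * C) ^ i * (Rabs (a O) * C ^ (S k - i))).
  + apply Rmult_le_compat; [apply Rabs_pos..|now apply IH|].
    replace (S k - i)%nat with (S (k - i)) by lia; apply H.
  + replace (C ^ S k) with (C ^ i * C ^ (S k - i))
      by (rewrite <- pow_add; f_equal; lia).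
    rewrite Rpow_mult_distr; right; field; lra.
- rewrite <- (scal_sum (fun i => 2 ^ i)), Rpow_mult_distr.
  apply Rle_trans with (C ^ S k * 2 ^ S k); [|right; ring].
  apply Rmult_le_compat_l; [left; now apply pow_lt|].
  assert (E : forall i, sum_f_R0 (fun i => 2 ^ i) i = 2 ^ S i - 1).
  { induction i as [|i IHi]; [simpl; ring|].
    rewrite tech5, IHi; simpl; ring. }
  rewrite E; lra.
Qed.

Lemma CV_radius_inv a : a O <> 0 -> Rbar_lt 0 (CV_radius a) ->
  Rbar_lt 0 (CV_radius (PS_inv a)).
Proof.
intros Ha H; destruct (CV_radius_bound a H) as (r & M & Hr & HM).
assert (Hpos : 0 < Rabs (a O)) by now apply Rabs_pos_lt.
(* [K] is at least 1 so that [M <= |a 0| K <= |a 0| K^(k+1)]; with [C = K / r] the bound [M] on the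
   terms at [r] becomes the hypothesis of [PS_inv_bound]. *)
set (K := Rmax 1 (M / Rabs (a O))).
assert (HK1 : 1 <= K) by apply Rmax_l.
assert (HKM : M <= Rabs (a O) * K).
{ replace M with (Rabs (a O) * (M / Rabs (a O))) by (field; lra).
  apply Rmult_le_compat_l; [lra | apply Rmax_r]. }
set (C := K / r).
assert (HC : 0 < C) by (apply Rdiv_lt_0_compat; lra).
apply CV_radius_pos with (/ (2 * C)) (/ Rabs (a O)).
- apply Rinv_0_lt_compat; lra.
- intros k; rewrite Rabs_mult.
  assert (Hp : 0 < (2 * C) ^ k) by (apply pow_lt; lra).
  rewrite pow_inv, (Rabs_pos_eq (/ _))
    by (left; now apply Rinv_0_lt_compat).
  apply Rmult_le_reg_r with ((2 * C) ^ k); [easy|].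
  rewrite Rmult_assoc, Rinv_l, Rmult_1_r by lra.
  apply PS_inv_bound; [easy..|]; clear k Hp; intros k.
  specialize (HM (S k)).
  assert (Hp : 0 < r ^ S k) by now apply pow_lt.
  rewrite Rabs_mult, (Rabs_pos_eq (r ^ S k)) in HM by lra.
  apply Rmult_le_reg_r with (r ^ S k); [easy|].
  apply Rle_trans with (1 := HM), Rle_trans with (1 := HKM).
  replace (Rabs (a O) * C ^ S k * r ^ S k) with (Rabs (a O) * K ^ S k).
  + apply Rmult_le_compat_l; [lra|].
    rewrite <- (pow_1 K) at 1; apply Rle_pow; [easy|lia].
  + rewrite Rmult_assoc, <- Rpow_mult_distr; unfold C.
    do 2 f_equal; field; lra.
Qed.

Lemma analytic_at_inv f x0 : f x0 <> 0 -> analytic_at f x0 ->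
  analytic_at (fun x => / f x) x0.
Proof.
intros H (a & Ha & Hf).
assert (Ha0 : a O <> 0).
{ rewrite <- PSeries_0, <- (locally_singleton _ _ Hf).
  now rewrite Rplus_0_r. }
assert (Hi := CV_radius_inv a Ha0 Ha).
exists (PS_inv a); split; [easy|].
generalize (filter_and _ _ (filter_and _ _ Hf (PSeries_const 1))
  (filter_and _ _ (locally_lt_CV_radius a Ha) (locally_lt_CV_radius _ Hi))).
apply filter_imp; intros u [[-> E] [H1 H2]].
rewrite <- (PSeries_ext _ _ u (fun k => PS_mult_inv a k Ha0)) in E.
rewrite PSeries_mult in E by easy.
assert (PSeries a u <> 0) by (intros E0; rewrite E0 in E; lra).
apply Rmult_eq_reg_r with (PSeries a u); [|easy].
now rewrite E, Rinv_l.
Qed.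

(** The series of [g] is integrated termwise with constant term [f x0]; the difference [D] from [f]
    has derivative zero between 0 and [u] and vanishes at 0. This handles the arctangent in
    [proj_lift] without composing series. *)
Lemma analytic_at_antiderivative f g x0 :
  (forall x, is_derive f x (g x)) -> analytic_at g x0 -> analytic_at f x0.
Proof.
intros Hd (a & Ha & Hg).
set (b := fun k => match k with O => f x0 | S j => a j / INR (S j) end).
assert (Hba : forall k, PS_derive b k = a k).
{ intros k; unfold PS_derive, b; field; apply not_0_INR; lia. }
assert (HR : CV_radius b = CV_radius a).
{ rewrite <- CV_radius_derive; now apply CV_radius_ext. }
exists b; split; [now rewrite HR|].
destruct (filter_and _ _ Hg (locally_lt_CV_radius a Ha)) as [r Hr].
exists r; intros u Hu.
change (Rabs (u - 0) < r) in Hu; rewrite Rminus_0_r in Hu.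
set (D := fun t => f (x0 + t) - PSeries b t).
assert (HD : forall t, Rabs t <= Rabs u -> is_derive D t zero).
{ intros t Ht.
  assert (Ht' : Hierarchy.ball 0 r t)
    by (change (Rabs (t - 0) < r); rewrite Rminus_0_r; lra).
  destruct (Hr t Ht') as [E1 E2].
  replace (@zero R_NormedModule) with (minus (g (x0 + t)) (PSeries (PS_derive b) t)).
  - apply (is_derive_minus (fun t => f (x0 + t)) (PSeries b) t).
    + auto_derive; [now exists (g (x0 + t))|].
      etransitivity; [apply Rmult_1_l | apply is_derive_unique, Hd].
    + apply is_derive_PSeries; now rewrite HR.
  - rewrite (PSeries_ext _ _ _ Hba), E1; apply @minus_eq_zero. }
assert (E : D u = D 0).
{ destruct (Rtotal_order u 0) as [Hn|[->|Hp]]; [|easy|].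
  - apply eq_is_derive; [|easy]; intros t Ht; apply HD.
    rewrite !Rabs_left1; lra.
  - symmetry; apply eq_is_derive; [|easy]; intros t Ht; apply HD.
    rewrite !Rabs_pos_eq; lra. }
unfold D in E; rewrite PSeries_0, Rplus_0_r in E; cbn [b] in E; lra.
Qed.

Lemma infinite_sum_scal (a b : nat -> R) (c l : R) :
  infinite_sum a l -> (forall k, b k = c * a k) -> is_series b (c * l).
Proof.
intros H E; apply is_series_ext with (fun k => c * a k); [easy|].
now apply (is_series_scal_l c a l), is_series_Reals.
Qed.

(** The coefficients are those of Taylor, since the [k]-th derivative of cosine shifts the argument
    by [k PI / 2]. The even and odd parts of the series are, up to constants, the series defining
    [cos] and [sin] at [w * u]. *)
Lemma analytic_at_cos w p x0 : analytic_at (fun x => cos (w * x + p)) x0.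
Proof.
set (t0 := w * x0 + p).
set (a := fun k => w ^ k / INR (fact k) * cos (t0 + INR k * (PI / 2))).
assert (Hper : forall k, cos (t0 + INR (2 * k) * (PI / 2)) = (-1) ^ k * cos t0 /\
                         sin (t0 + INR (2 * k) * (PI / 2)) = (-1) ^ k * sin t0).
{ induction k as [|k [IH1 IH2]].
  - simpl; rewrite Rmult_0_l, Rplus_0_r; lra.
  - replace (INR (2 * S k) * (PI / 2)) with (INR (2 * k) * (PI / 2) + PI)
      by (rewrite <- (Nat.add_1_r k), Nat.mul_add_distr_l, plus_INR;
          simpl (INR (2 * 1)); field).
    rewrite <- Rplus_assoc, neg_cos, neg_sin, IH1, IH2; simpl; lra. }
exists a; split.
- assert (Hw : 0 <= Rabs w) by apply Rabs_pos.
  (* The added 1 keeps the radius meaningful when [w = 0]. *)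
  apply CV_radius_pos with (/ (Rabs w + 1)) 1;
    [apply Rinv_0_lt_compat; lra|].
  intros k; unfold a; set (th := t0 + INR k * (PI / 2)).
  rewrite Rabs_mult, Rabs_pos_eq with (x := (/ (Rabs w + 1)) ^ k)
    by (apply pow_le; left; apply Rinv_0_lt_compat; lra).
  unfold Rdiv; rewrite !Rabs_mult, <- RPow_abs.
  assert (H1 : Rabs w ^ k * (/ (Rabs w + 1)) ^ k <= 1).
  { rewrite <- Rpow_mult_distr; apply Rle_trans with (1 ^ k);
      [|rewrite pow1; lra].
    apply pow_incr; split.
    - apply Rmult_le_pos; [easy | left; apply Rinv_0_lt_compat; lra].
    - apply Rmult_le_reg_r with (Rabs w + 1); [lra|].
      rewrite Rmult_assoc, Rinv_l; lra. }
  assert (H2 : 0 < / INR (fact k) <= 1).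
  { assert (1 <= INR (fact k)) by (apply (le_INR 1); apply lt_O_fact).
    split; [apply Rinv_0_lt_compat; lra|].
    rewrite <- Rinv_1; apply Rinv_le_contravar; lra. }
  assert (H3 : Rabs (cos th) <= 1)
    by (apply Rabs_le, COS_bound).
  assert (H4 := Rabs_pos (cos th)).
  rewrite (Rabs_pos_eq (/ INR _)) by lra.
  replace (Rabs w ^ k * / INR (fact k) * Rabs (cos th) *
           (/ (Rabs w + 1)) ^ k) with
    ((Rabs w ^ k * (/ (Rabs w + 1)) ^ k) *
     (/ INR (fact k) * Rabs (cos th))) by ring.
  assert (H5 : 0 <= Rabs w ^ k * (/ (Rabs w + 1)) ^ k).
  { apply Rmult_le_pos; apply pow_le; [easy|].
    left; apply Rinv_0_lt_compat; lra. }
  assert (H6 : / INR (fact k) * Rabs (cos th) <= 1 * 1)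
    by (apply Rmult_le_compat; lra).
  apply Rle_trans with (1 * 1); [|lra].
  apply Rmult_le_compat; [easy| |easy|lra].
  apply Rmult_le_pos; lra.
- apply filter_forall; intros u; symmetry; apply is_pseries_unique.
  replace (w * (x0 + u) + p) with (t0 + w * u) by (unfold t0; ring).
  rewrite cos_plus.
  (* [sin] is defined as its argument times a series in the square; the factor [u] is pulled out to
     match the odd part in [is_pseries_odd_even]. *)
  replace (cos t0 * cos (w * u) - sin t0 * sin (w * u)) with
    (cos t0 * cos (w * u) +
     u * (- sin t0 * w * (let (s, _) := exist_sin (Rsqr (w * u)) in s)))
    by (unfold sin at 3; destruct (exist_sin _); ring).
  assert (Hsq : forall i, (Rsqr (w * u)) ^ i = w ^ (2 * i) * (u ^ 2) ^ i).
  { intros i; rewrite pow_mult, <- Rpow_mult_distr; f_equal.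
    unfold Rsqr; ring. }
  apply is_pseries_odd_even; apply is_pseries_R.
  + unfold cos at 2; destruct (exist_cos (Rsqr (w * u))) as [l Hl].
    apply (infinite_sum_scal _ _ _ _ Hl); intros i.
    unfold a; rewrite (proj1 (Hper i)), Hsq; unfold cos_n.
    field; apply INR_fact_neq_0.
  + destruct (exist_sin (Rsqr (w * u))) as [l Hl].
    apply (infinite_sum_scal _ _ _ _ Hl); intros i.
    assert (E : cos (t0 + INR (2 * i + 1) * (PI / 2)) = - ((-1) ^ i * sin t0)).
    { rewrite plus_INR, Rmult_plus_distr_r, Rmult_1_l, <- Rplus_assoc.
      now rewrite cos_plus, cos_PI2, sin_PI2, (proj2 (Hper i)); ring. }
    unfold a; rewrite E, Hsq, pow_add; unfold sin_n.
    field; apply INR_fact_neq_0.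
Qed.

(** * Lifts of projective maps *)

(** The tangent of the angle from [PI * t] to its image: for [u = tan (PI * t)] it is
    [(l u - u) / (1 + l u^2)], cleared by [cos^2] so that it also makes sense where [u] is
    infinite. *)
Definition slope (l t : R) : R :=
  (l - 1) * sin (PI * t) * cos (PI * t) /
  (cos (PI * t) ^ 2 + l * sin (PI * t) ^ 2).

(* The lift to [R] of the projective map [u |-> l * u], in the coordinate
   [u = tan (PI * t)] of the circle [R / Z]. *)
Definition proj_lift (l t : R) : R := t + atan (slope l t) / PI.

Lemma sin2_cos2_pow x : sin x ^ 2 + cos x ^ 2 = 1.
Proof. generalize (sin2_cos2 x); unfold Rsqr; lra. Qed.

Lemma denom_pos l x : 0 < l -> 0 < cos x ^ 2 + l * sin x ^ 2.
Proof.
intros Hl; generalize (sin2_cos2_pow x) (pow2_ge_0 (sin x)) (pow2_ge_0 (cos x)).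
intros H1 H2 H3; destruct (Rle_lt_or_eq_dec _ _ H3) as [H|H].
- nra.
- rewrite <- H in *; nra.
Qed.

(** The unit vector at angle [PI * proj_lift l t] is [k / D] times [(c, l * s)], which is the map
    [u |-> l u]. The map of ratio [/ l] thus turns back by the same angle. *)
Lemma slope_proj_lift l t : 0 < l -> slope (/ l) (proj_lift l t) = - slope l t.
Proof.
intros Hl.
assert (HD := denom_pos l (PI * t) Hl).
assert (H1 := sin2_cos2_pow (PI * t)).
set (q := slope l t).
set (k := cos (atan q)).
assert (Hk : 0 < k).
{ apply cos_gt_0; generalize (atan_bound q); lra. }
assert (Hs : sin (atan q) = q * k).
{ generalize (tan_atan q); unfold tan; fold k; intros E.
  rewrite <- E at 2; field; lra. }
assert (E : PI * proj_lift l t = PI * t + atan q).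
{ unfold proj_lift; fold q; field; apply PI_neq0. }
unfold slope at 1; rewrite E, sin_plus, cos_plus, Hs; fold k.
unfold q, slope; clear E Hs.
set (s := sin (PI * t)) in *; set (c := cos (PI * t)) in *.
set (D := c ^ 2 + l * s ^ 2) in *.
(* Inserting [s^2 + c^2 = 1] makes both sides homogeneous, which leaves an identity for [field]. *)
assert (Ec : c * k - s * ((l - 1) * s * c / D * k) = k * c / D).
{ replace (k * c / D) with (k * c * (s ^ 2 + c ^ 2) / D)
    by (rewrite H1; field; lra).
  unfold D; field; fold D; lra. }
assert (Es : s * k + c * ((l - 1) * s * c / D * k) = k * l * s / D).
{ replace (k * l * s / D) with (k * l * s * (s ^ 2 + c ^ 2) / D)
    by (rewrite H1; field; lra).
  unfold D; field; fold D; lra. }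
rewrite Ec, Es.
replace ((k * c / D) ^ 2 + / l * (k * l * s / D) ^ 2) with (k ^ 2 / D)
  by (unfold D; field; fold D; lra).
field; lra.
Qed.

Lemma proj_lift_inv l t : 0 < l -> proj_lift (/ l) (proj_lift l t) = t.
Proof.
intros Hl; unfold proj_lift at 1; rewrite slope_proj_lift, atan_opp by easy.
unfold proj_lift; field; apply PI_neq0.
Qed.

Lemma proj_lift_inv' l t : 0 < l -> proj_lift l (proj_lift (/ l) t) = t.
Proof.
intros Hl; rewrite <- (Rinv_inv l) at 1.
now apply proj_lift_inv, Rinv_0_lt_compat.
Qed.

Lemma proj_lift_succ l t : proj_lift l (t + 1) = proj_lift l t + 1.
Proof.
unfold proj_lift, slope.
replace (PI * (t + 1)) with (PI * t + PI) by ring.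
rewrite neg_sin, neg_cos.
replace ((l - 1) * - sin (PI * t) * - cos (PI * t))
  with ((l - 1) * sin (PI * t) * cos (PI * t)) by ring.
replace ((- cos (PI * t)) ^ 2 + l * (- sin (PI * t)) ^ 2)
  with (cos (PI * t) ^ 2 + l * sin (PI * t) ^ 2) by ring.
ring.
Qed.

Lemma proj_lift_shift l t k : proj_lift l (t + IZR k) = proj_lift l t + IZR k.
Proof.
induction k as [|k IH|k IH] using Z.peano_ind.
- now rewrite !Rplus_0_r.
- rewrite succ_IZR, <- !Rplus_assoc, proj_lift_succ, IH; ring.
- assert (E : IZR k = IZR (Z.pred k) + 1) by now rewrite <- succ_IZR, Z.succ_pred.
  rewrite E, <- Rplus_assoc, proj_lift_succ in IH; lra.
Qed.

Lemma proj_lift_opp l t : proj_lift l (- t) = - proj_lift l t.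
Proof.
unfold proj_lift, slope.
rewrite Ropp_mult_distr_r_reverse, sin_neg, cos_neg.
replace ((l - 1) * - sin (PI * t) * cos (PI * t) /
         (cos (PI * t) ^ 2 + l * (- sin (PI * t)) ^ 2))
  with (- ((l - 1) * sin (PI * t) * cos (PI * t) /
         (cos (PI * t) ^ 2 + l * sin (PI * t) ^ 2)))
  by (replace ((- sin (PI * t)) ^ 2) with (sin (PI * t) ^ 2) by ring;
      unfold Rdiv; ring).
rewrite atan_opp; unfold Rdiv; ring.
Qed.

(** This is [l / (cos^2 + l^2 sin^2)] at [PI * t], rewritten with the double angle so that only one
    cosine occurs. *)
Definition proj_deriv (l t : R) : R :=
  l * / ((1 + l ^ 2) / 2 + (1 - l ^ 2) / 2 * cos (2 * PI * t)).

(** A convex combination of [1] and [l^2], with weights [(1 + cos) / 2] and [(1 - cos) / 2]. *)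
Lemma proj_deriv_denom l t : 0 < l ->
  0 < (1 + l ^ 2) / 2 + (1 - l ^ 2) / 2 * cos (2 * PI * t).
Proof.
intros Hl; generalize (COS_bound (2 * PI * t)) (pow2_gt_0 l); intros H1 H2.
assert (H3 : 0 < l ^ 2) by (apply H2; lra).
destruct (Rle_lt_dec 0 (cos (2 * PI * t))); nra.
Qed.

Lemma is_derive_proj_lift l t : 0 < l ->
  is_derive (proj_lift l) t (proj_deriv l t).
Proof.
intros Hl.
assert (HD := denom_pos l (PI * t) Hl).
assert (HE := denom_pos (l ^ 2) (PI * t) (pow_lt l 2 Hl)).
assert (H1 := sin2_cos2_pow (PI * t)).
assert (E0 : proj_deriv l t = l / (cos (PI * t) ^ 2 + l ^ 2 * sin (PI * t) ^ 2)).
{ unfold proj_deriv, Rdiv; do 2 f_equal.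
  replace (2 * PI * t) with (2 * (PI * t)) by ring.
  rewrite cos_2a.
  replace (1 + l ^ 2) with ((1 + l ^ 2) * (sin (PI * t) ^ 2 + cos (PI * t) ^ 2))
    by (rewrite H1; ring).
  field. }
rewrite E0; unfold proj_lift, slope; auto_derive; [simpl; simpl in HD; lra|].
set (s := sin (PI * t)) in *; set (c := cos (PI * t)) in *.
assert (Hq : 1 + ((l - 1) * s * c * / (c ^ 2 + l * s ^ 2)) ^ 2 =
             (c ^ 2 + l ^ 2 * s ^ 2) / (c ^ 2 + l * s ^ 2) ^ 2).
{ replace (c ^ 2 + l ^ 2 * s ^ 2) with
    ((c ^ 2 + l ^ 2 * s ^ 2) * (s ^ 2 + c ^ 2)) by (rewrite H1; ring).
  field; lra. }
set (D := c ^ 2 + l * s ^ 2) in *.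
set (E := c ^ 2 + l ^ 2 * s ^ 2) in *.
change (c * (c * 1) + l * (s * (s * 1))) with D.
change ((l - 1) * s * c * / D * ((l - 1) * s * c * / D * 1))
  with (((l - 1) * s * c * / D) ^ 2).
rewrite Hq.
(* The derivative of [atan (slope l t) / PI] is [(l - 1) (c^2 - l s^2) (s^2 + c^2) / E]; adding 1
   leaves the numerator [l (s^2 + c^2)]. *)
match goal with |- 1 + ?x = _ => transitivity
  (1 + (l - 1) * (c ^ 2 - l * s ^ 2) * (s ^ 2 + c ^ 2) / E);
  [apply f_equal | rewrite H1; transitivity (l * (s ^ 2 + c ^ 2) / E)] end.
- unfold E, D in *; field; repeat split; first [apply PI_neq0 | lra].
- unfold E in *; field; lra.
- rewrite H1; field; lra.
Qed.

Lemma proj_lift_increasing l x y : 0 < l -> x < y ->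
  proj_lift l x < proj_lift l y.
Proof.
intros Hl Hxy.
apply (incr_function (proj_lift l) m_infty p_infty (proj_deriv l)); simpl; auto.
- intros; now apply is_derive_proj_lift.
- intros t _ _; apply Rmult_lt_0_compat; [easy|].
  now apply Rinv_0_lt_compat, proj_deriv_denom.
Qed.

(** Affine changes on both sides let one statement cover [stretch] and its inverse, which is again
    built on a [proj_lift]. *)
Lemma analytic_affine_proj_lift f l A B C E : 0 < l ->
  (forall x, f x = B * proj_lift l (C * x + E) + A) -> real_analytic f.
Proof.
intros Hl Hf; apply analytic_real_analytic; intros x0.
apply analytic_at_ext with (fun x => B * proj_lift l (C * x + E) + A); [easy|].
apply analytic_at_antiderivative with
  (fun x => (B * C * l) * / ((1 + l ^ 2) / 2 +
     (1 - l ^ 2) / 2 * cos (2 * PI * C * x + 2 * PI * E))).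
- intros x; auto_derive.
  + now exists (proj_deriv l (C * x + E)); apply is_derive_proj_lift.
  + replace (Derive (fun x => proj_lift l x) (C * x + E))
      with (proj_deriv l (C * x + E))
      by (symmetry; now apply is_derive_unique, is_derive_proj_lift).
    unfold proj_deriv.
    replace (2 * PI * (C * x + E)) with (2 * PI * C * x + 2 * PI * E) by ring.
    ring.
- apply (analytic_at_mult (fun _ => B * C * l)); [apply analytic_at_const|].
  apply analytic_at_inv.
  + replace (2 * PI * C * x0 + 2 * PI * E) with (2 * PI * (C * x0 + E)) by ring.
    generalize (proj_deriv_denom l (C * x0 + E) Hl); lra.
  + apply analytic_at_plus; [apply analytic_at_const|].
    apply analytic_at_mult; [apply analytic_at_const | apply analytic_at_cos].
Qed.

(** The ratio taking [tan (PI * d)] to its inverse, which is [tan (PI * (1 / 2 - d))]. *)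
Definition contraction_ratio (d : R) : R := / tan (PI * d) ^ 2.

Lemma contraction_ratio_pos d : 0 < d < 1 / 2 -> 0 < contraction_ratio d.
Proof.
intros Hd; apply Rinv_0_lt_compat, pow_lt, tan_gt_0; generalize PI_RGT_0; nra.
Qed.

Lemma proj_lift_contraction d : 0 < d < 1 / 2 ->
  proj_lift (contraction_ratio d) d = 1 / 2 - d.
Proof.
intros Hd; assert (Hpi := PI_RGT_0); unfold proj_lift.
(* The image angle [PI / 2 - PI * d] minus [PI * d], which lies in the range of the arctangent. *)
replace (slope (contraction_ratio d) d) with (tan (PI / 2 - 2 * (PI * d))).
- rewrite atan_tan by nra; field; lra.
- assert (Hs : 0 < sin (PI * d)) by (apply sin_gt_0; nra).
  assert (Hc : 0 < cos (PI * d)) by (apply cos_gt_0; nra).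
  unfold slope, contraction_ratio, tan.
  rewrite sin_shift, cos_shift, cos_2a, sin_2a.
  field; split; [lra|]; split; [lra|]; nra.
Qed.

(** By monotonicity only the endpoints matter: [d] goes to [1/2 - d], and by oddness and periodicity
    [1 - d] goes to [1/2 + d]. *)
Lemma proj_lift_contracts d t k : 0 < d < 1 / 2 ->
  d <= t - IZR k <= 1 - d ->
  Rabs (proj_lift (contraction_ratio d) t - 1 / 2 - IZR k) <= d.
Proof.
intros Hd Ht; set (l := contraction_ratio d).
assert (Hl : 0 < l) by now apply contraction_ratio_pos.
assert (mono : forall x y, x <= y -> proj_lift l x <= proj_lift l y).
{ intros x y [H|<-]; [left; now apply proj_lift_increasing | right; easy]. }
replace t with (t - IZR k + IZR k) by ring.
rewrite proj_lift_shift.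
assert (H1 := mono _ _ (proj1 Ht)); assert (H2 := mono _ _ (proj2 Ht)).
replace (1 - d) with (- d + 1) in H2 by ring.
rewrite proj_lift_succ, proj_lift_opp in H2.
unfold l in H1, H2; rewrite proj_lift_contraction in H1, H2 by easy.
apply Rabs_le_between; unfold l; lra.
Qed.

(** * Actions on the interval and on the circle *)

Lemma word_eval_semiconj {X Y} (phi : X -> Y) f finv g ginv F Finv G Ginv :
  (forall x, F (phi x) = phi (f x)) -> (forall x, Finv (phi x) = phi (finv x)) ->
  (forall x, G (phi x) = phi (g x)) -> (forall x, Ginv (phi x) = phi (ginv x)) ->
  forall w x, word_eval F Finv G Ginv w (phi x) = phi (word_eval f finv g ginv w x).
Proof.
intros Hf Hfi Hg Hgi w x; induction w as [|[[] []] w IH];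
  cbn [word_eval letter_eval]; [easy|..]; rewrite IH; auto.
Qed.

(** [T] extends a map of [X], carried over by [phi], to points outside the image of [phi]. Those of
    them in [D] are fixed by everything, so the image of [phi] decides which words act trivially. *)
Lemma embeds_BS_transfer {X Y} (D : Y -> Prop) (phi : X -> Y)
    (T : (X -> X) -> Y -> Y) m n f finv g ginv :
  (forall x, D (phi x)) -> (forall x y, phi x = phi y -> x = y) ->
  (forall h x, T h (phi x) = phi (h x)) ->
  (forall y, D y -> (exists x, y = phi x) \/ (forall h, T h y = y)) ->
  embeds_BS (fun _ => True) m n f finv g ginv ->
  embeds_BS D m n (T f) (T finv) (T g) (T ginv).
Proof.
intros HD Hinj HT Hcov H w; rewrite <- (H w).
assert (E : forall x, word_eval (T f) (T finv) (T g) (T ginv) w (phi x) =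
                      phi (word_eval f finv g ginv w x))
  by (apply word_eval_semiconj; auto).
split; intros Hw.
- intros x _; apply Hinj; rewrite <- E; auto.
- intros y Hy; destruct (Hcov y Hy) as [[x ->]|Hfix].
  + now rewrite E, Hw.
  (* A common fixed point is a semiconjugacy from the one-point space. *)
  + set (id1 := fun u : unit => u).
    exact (word_eval_semiconj (fun _ : unit => y) id1 id1 id1 id1 _ _ _ _
             (fun _ => Hfix f) (fun _ => Hfix finv) (fun _ => Hfix g)
             (fun _ => Hfix ginv) w tt).
Qed.

(** * Increasing bijections of the line *)

Definition increasing_pair (f finv : R -> R) : Prop :=
  (forall x, f (finv x) = x) /\ (forall x, finv (f x) = x) /\
  (forall x y, x < y -> f x < f y).

Lemma increasing_pair_sym f finv : increasing_pair f finv -> increasing_pair finv f.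
Proof.
intros (H1 & H2 & H3); split; [|split]; auto; intros x y Hxy.
destruct (Rtotal_order (finv x) (finv y)) as [H|[H|H]]; [easy|..].
- apply (f_equal f) in H; rewrite !H1 in H; lra.
- apply H3 in H; rewrite !H1 in H; lra.
Qed.

(** The preimages of [f x - eps] and [f x + eps] enclose [x], and monotonicity traps [f y] for every
    [y] between them. *)
Lemma increasing_pair_continuous f finv x eps : increasing_pair f finv -> 0 < eps ->
  exists delta, 0 < delta /\
    forall y, Rabs (y - x) < delta -> Rabs (f y - f x) < eps.
Proof.
intros H Heps; assert (H' := increasing_pair_sym _ _ H).
destruct H as (H1 & H2 & H3), H' as (_ & _ & H4).
exists (Rmin (x - finv (f x - eps)) (finv (f x + eps) - x)); split.
- assert (Ha : finv (f x - eps) < finv (f x)) by (apply H4; lra).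
  assert (Hb : finv (f x) < finv (f x + eps)) by (apply H4; lra).
  rewrite H2 in Ha, Hb; apply Rmin_glb_lt; lra.
- intros y Hy; apply Rmin_Rgt in Hy; destruct Hy as [Ha Hb].
  apply Rabs_def2 in Ha; apply Rabs_def2 in Hb.
  assert (Hc : f (finv (f x - eps)) < f y) by (apply H3; lra).
  assert (Hd : f y < f (finv (f x + eps))) by (apply H3; lra).
  rewrite H1 in Hc, Hd; apply Rabs_def1; lra.
Qed.

(** * Conjugation to the interval *)

Definition to_unit (x : R) : R := 1 / 2 + atan x / PI.

Lemma to_unit_bounds x : 0 < to_unit x < 1.
Proof.
assert (Hpi := PI_RGT_0); unfold to_unit; destruct (atan_bound x) as [H1 H2].
assert (E : (1 / 2 + atan x / PI) * PI = PI / 2 + atan x) by (field; lra).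
split; apply Rmult_lt_reg_r with PI; try easy; rewrite E; lra.
Qed.

Lemma to_unit_increasing x y : x < y -> to_unit x < to_unit y.
Proof.
intros H; apply atan_increasing in H; apply Rplus_lt_compat_l.
apply Rmult_lt_compat_r; [apply Rinv_0_lt_compat, PI_RGT_0 | easy].
Qed.

Lemma to_unit_inj x y : to_unit x = to_unit y -> x = y.
Proof.
intros E; destruct (Rtotal_order x y) as [H|[H|H]]; [|easy|];
  apply to_unit_increasing in H; lra.
Qed.

Definition of_unit (y : R) : R := tan (PI * (y - 1 / 2)).

Lemma to_of_unit y : 0 < y < 1 -> to_unit (of_unit y) = y.
Proof.
intros H; assert (Hpi := PI_RGT_0); unfold to_unit, of_unit.
rewrite atan_tan by nra; field; lra.
Qed.

Lemma of_to_unit x : of_unit (to_unit x) = x.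
Proof. apply to_unit_inj, to_of_unit, to_unit_bounds. Qed.

Definition unit_conj (f : R -> R) (y : R) : R :=
  if Rlt_dec 0 y then if Rlt_dec y 1 then to_unit (f (of_unit y)) else y else y.

Lemma unit_conj_to_unit f x : unit_conj f (to_unit x) = to_unit (f x).
Proof.
destruct (to_unit_bounds x); unfold unit_conj.
destruct (Rlt_dec 0 (to_unit x)); [|easy].
destruct (Rlt_dec (to_unit x) 1); [|easy].
now rewrite of_to_unit.
Qed.

Lemma unit_conj_cases y :
  (exists x, y = to_unit x) \/ (y <= 0 \/ 1 <= y) /\ forall f, unit_conj f y = y.
Proof.
unfold unit_conj; destruct (Rlt_dec 0 y); [destruct (Rlt_dec y 1)|].
- left; exists (of_unit y); now rewrite to_of_unit.
- right; split; [lra | easy].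
- right; split; [lra | easy].
Qed.

(** Being the identity outside [(0, 1)], the conjugate is an increasing bijection of the whole line;
    continuity at the endpoints of the interval then follows from monotonicity. *)
Lemma unit_conj_increasing_pair f finv : increasing_pair f finv ->
  increasing_pair (unit_conj f) (unit_conj finv).
Proof.
intros (H1 & H2 & H3); split; [|split].
- intros y; destruct (unit_conj_cases y) as [[x ->]|[_ E]].
  + now rewrite !unit_conj_to_unit, H1.
  + now rewrite !E.
- intros y; destruct (unit_conj_cases y) as [[x ->]|[_ E]].
  + now rewrite !unit_conj_to_unit, H2.
  + now rewrite !E.
- intros y z Hyz.
  destruct (unit_conj_cases y) as [[x ->]|[Hy Ey]];
    destruct (unit_conj_cases z) as [[x' ->]|[Hz Ez]];
    rewrite ?unit_conj_to_unit, ?Ey, ?Ez.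
  + apply to_unit_increasing, H3.
    destruct (Rtotal_order x x') as [H|[->|H]]; [easy|lra|].
    apply to_unit_increasing in H; lra.
  + generalize (to_unit_bounds x) (to_unit_bounds (f x)); lra.
  + generalize (to_unit_bounds x') (to_unit_bounds (f x')); lra.
  + easy.
Qed.

Lemma unit_conj_unitI f y : unitI y -> unitI (unit_conj f y).
Proof.
intros Hy; destruct (unit_conj_cases y) as [[x ->]|[_ E]].
- rewrite unit_conj_to_unit; unfold unitI; generalize (to_unit_bounds (f x)); lra.
- now rewrite E.
Qed.

Lemma increasing_pair_continuous_on_I f finv :
  increasing_pair f finv -> continuous_on_I f.
Proof.
intros H x _ eps Heps.
destruct (increasing_pair_continuous f finv x eps H Heps) as (d & Hd & Hc).
exists d; auto.
Qed.

Lemma unit_conj_homeo f finv : increasing_pair f finv ->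
  is_homeo_plus_I (unit_conj f) (unit_conj finv).
Proof.
intros H; apply unit_conj_increasing_pair in H.
assert (H' := increasing_pair_sym _ _ H).
assert (Hc := increasing_pair_continuous_on_I _ _ H).
assert (Hc' := increasing_pair_continuous_on_I _ _ H').
destruct H as (H1 & H2 & H3).
repeat split; auto; apply unit_conj_unitI; easy.
Qed.

(** * Conjugation to the circle *)

(* Stereographic parametrization of the circle minus [(-1, 0)]. *)
Definition to_circle (t : R) : pt :=
  ((1 - t ^ 2) / (1 + t ^ 2), 2 * t / (1 + t ^ 2)).

Definition of_circle (p : pt) : R := snd p / (1 + fst p).

Definition pole : pt := (-1, 0).

Lemma one_plus_sqr_pos t : 0 < 1 + t ^ 2.
Proof. generalize (pow2_ge_0 t); lra. Qed.

Lemma to_circle_on_circle t : on_circle (to_circle t).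
Proof.
unfold on_circle; cbn [to_circle fst snd]; field.
generalize (one_plus_sqr_pos t); lra.
Qed.

Lemma of_to_circle t : of_circle (to_circle t) = t.
Proof.
unfold of_circle; cbn [to_circle fst snd]; field.
generalize (one_plus_sqr_pos t); intros H; split; [|lra].
replace (1 + t ^ 2 + (1 - t ^ 2)) with 2 by ring; lra.
Qed.

Lemma to_circle_inj s t : to_circle s = to_circle t -> s = t.
Proof. intros E; now rewrite <- (of_to_circle s), E, of_to_circle. Qed.

(** On the circle the test singles out [pole], the point at infinity of the line. *)
Definition circle_conj (f : R -> R) (p : pt) : pt :=
  if Req_EM_T (fst p) (-1) then p else to_circle (f (of_circle p)).

Lemma circle_conj_pole f : circle_conj f pole = pole.
Proof. unfold circle_conj; now destruct (Req_EM_T (fst pole) (-1)). Qed.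

Lemma circle_conj_to_circle f t : circle_conj f (to_circle t) = to_circle (f t).
Proof.
unfold circle_conj; destruct (Req_EM_T (fst (to_circle t)) (-1)) as [E|_].
- exfalso; cbn [to_circle fst] in E.
  assert (H := one_plus_sqr_pos t).
  apply (f_equal (fun x => x * (1 + t ^ 2))) in E.
  unfold Rdiv in E; rewrite Rmult_assoc, Rinv_l in E; lra.
- now rewrite of_to_circle.
Qed.

Lemma circle_cases p : on_circle p -> p = pole \/ exists t, p = to_circle t.
Proof.
destruct p as [x y]; unfold on_circle; cbn [fst snd]; intros H.
destruct (Req_EM_T x (-1)) as [->|ne].
- left; unfold pole; f_equal; apply Rsqr_0_uniq; unfold Rsqr; lra.
- right; exists (y / (1 + x)); unfold to_circle.
  assert (H1 : 1 + x <> 0) by lra.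
  assert (E : 1 + (y / (1 + x)) ^ 2 = 2 / (1 + x)).
  { replace ((y / (1 + x)) ^ 2) with (y ^ 2 / (1 + x) ^ 2) by (field; easy).
    replace (y ^ 2) with (1 - x ^ 2) by lra; field; easy. }
  rewrite E; f_equal.
  + replace (1 - (y / (1 + x)) ^ 2) with (2 - (1 + (y / (1 + x)) ^ 2)) by ring.
    rewrite E; field; easy.
  + field; easy.
Qed.

Lemma orient_to_circle a b c : orient (to_circle a) (to_circle b) (to_circle c) =
  4 * ((b - a) * (c - a) * (c - b)) / ((1 + a ^ 2) * (1 + b ^ 2) * (1 + c ^ 2)).
Proof.
unfold orient; cbn [to_circle fst snd]; field.
generalize (one_plus_sqr_pos a) (one_plus_sqr_pos b) (one_plus_sqr_pos c); lra.
Qed.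

(** The limit of [orient_to_circle] as [a] tends to infinity. *)
Lemma orient_pole_to_circle b c : orient pole (to_circle b) (to_circle c) =
  4 * (c - b) / ((1 + b ^ 2) * (1 + c ^ 2)).
Proof.
unfold orient; cbn [to_circle pole fst snd]; field.
generalize (one_plus_sqr_pos b) (one_plus_sqr_pos c); lra.
Qed.

Lemma orient_cycle p q r : orient p q r = orient q r p.
Proof. unfold orient; ring. Qed.

Lemma orient_eq_l p q : orient p p q = 0.
Proof. unfold orient; ring. Qed.

Lemma Rdiv_pos_iff x y : 0 < y -> (0 < x / y <-> 0 < x).
Proof.
intros Hy; split; intros H.
- replace x with (x / y * y) by (field; lra); now apply Rmult_lt_0_compat.
- now apply Rdiv_lt_0_compat.
Qed.

Lemma orient_to_circle_pos a b c :
  0 < orient (to_circle a) (to_circle b) (to_circle c) <->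
  0 < (b - a) * (c - a) * (c - b).
Proof.
rewrite orient_to_circle, Rdiv_pos_iff; [lra|].
generalize (one_plus_sqr_pos a) (one_plus_sqr_pos b) (one_plus_sqr_pos c).
intros; repeat apply Rmult_lt_0_compat; easy.
Qed.

Lemma orient_pole_to_circle_pos b c :
  0 < orient pole (to_circle b) (to_circle c) <-> b < c.
Proof.
rewrite orient_pole_to_circle, Rdiv_pos_iff; [lra|].
generalize (one_plus_sqr_pos b) (one_plus_sqr_pos c).
intros; apply Rmult_lt_0_compat; easy.
Qed.

(** The right-hand side involves only the order of the line, so increasing maps preserve it. *)
Lemma cyclic_order_iff a b c : 0 < (b - a) * (c - a) * (c - b) <->
  (a < b /\ b < c) \/ (b < c /\ c < a) \/ (c < a /\ a < b).
Proof.
assert (P : forall x y z, 0 < x -> 0 < y -> 0 < z -> 0 < x * y * z)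
  by (intros; repeat apply Rmult_lt_0_compat; easy).
assert (Q : forall x y z, 0 <= x -> 0 <= y -> 0 <= z -> 0 <= x * y * z)
  by (intros; repeat apply Rmult_le_pos; easy).
split.
- intros H; apply NNPP; intros Hn.
  (* Without a strict cyclic order the points are weakly in the reverse one, where the product is at
     most 0. *)
  assert (Hle : (a <= c <= b) \/ (c <= b <= a) \/ (b <= a <= c)).
  { destruct (Rlt_le_dec a b), (Rlt_le_dec b c), (Rlt_le_dec c a);
      first [ left; lra | right; left; lra | right; right; lra
            | destruct Hn; tauto ]. }
  destruct Hle as [Hle|[Hle|Hle]].
  + generalize (Q (b - a) (c - a) (b - c)); lra.
  + generalize (Q (a - b) (a - c) (b - c)); lra.
  + generalize (Q (a - b) (c - a) (c - b)); lra.
- intros [H|[H|H]].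
  + generalize (P (b - a) (c - a) (c - b)); lra.
  + generalize (P (a - b) (a - c) (c - b)); lra.
  + generalize (P (b - a) (a - c) (b - c)); lra.
Qed.

(** Two arguments at [pole] make [orient] vanish; a single one is rotated to the first place, where
    orientation is the order of the line; with none it is the cyclic order of the parameters. *)
Lemma circle_conj_orient f p q r : (forall x y, x < y -> f x < f y) ->
  on_circle p -> on_circle q -> on_circle r -> 0 < orient p q r ->
  0 < orient (circle_conj f p) (circle_conj f q) (circle_conj f r).
Proof.
intros Hf Hp Hq Hr.
assert (Hpole : forall b c, 0 < orient pole (to_circle b) (to_circle c) ->
  0 < orient pole (to_circle (f b)) (to_circle (f c))).
{ intros b c; rewrite !orient_pole_to_circle_pos; apply Hf. }
destruct (circle_cases p Hp) as [->|[a ->]];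
  destruct (circle_cases q Hq) as [->|[b ->]];
  destruct (circle_cases r Hr) as [->|[c ->]];
  rewrite ?circle_conj_pole, ?circle_conj_to_circle.
- easy.
- now rewrite !orient_eq_l.
- now rewrite <- !(orient_cycle pole), !orient_eq_l.
- apply Hpole.
- now rewrite !(orient_cycle (to_circle _)), !orient_eq_l.
- rewrite !(orient_cycle (to_circle _)); apply Hpole.
- rewrite <- !(orient_cycle pole); apply Hpole.
- rewrite !orient_to_circle_pos.
  rewrite !cyclic_order_iff; intuition.
Qed.

Lemma dist2_lt p q e : 0 < e ->
  (dist2 p q < e <-> (fst p - fst q) ^ 2 + (snd p - snd q) ^ 2 < e ^ 2).
Proof.
intros He; unfold dist2; set (d := _ + _).
assert (Hd : 0 <= d) by (unfold d; generalize (pow2_ge_0 (fst p - fst q))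
                           (pow2_ge_0 (snd p - snd q)); lra).
rewrite <- (sqrt_pow2 e) at 1 by lra; split; intros H.
- apply sqrt_lt_0_alt; easy.
- apply sqrt_lt_1_alt; lra.
Qed.

(** The chordal distance is [2 |s - t| / sqrt ((1 + s^2) (1 + t^2))]; squaring removes the root. *)
Lemma dist2_to_circle_lt s t e : 0 < e ->
  (dist2 (to_circle s) (to_circle t) < e <->
   4 * (s - t) ^ 2 < e ^ 2 * ((1 + s ^ 2) * (1 + t ^ 2))).
Proof.
intros He; rewrite dist2_lt by easy; cbn [to_circle fst snd].
assert (Hs := one_plus_sqr_pos s); assert (Ht := one_plus_sqr_pos t).
assert (Hst := Rmult_lt_0_compat _ _ Hs Ht).
replace (((1 - s ^ 2) / (1 + s ^ 2) - (1 - t ^ 2) / (1 + t ^ 2)) ^ 2 +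
         (2 * s / (1 + s ^ 2) - 2 * t / (1 + t ^ 2)) ^ 2)
  with (4 * (s - t) ^ 2 / ((1 + s ^ 2) * (1 + t ^ 2))) by (field; lra).
now apply Rlt_div_l.
Qed.

Lemma dist2_to_circle_pole_lt t e : 0 < e ->
  (dist2 (to_circle t) pole < e <-> 4 < e ^ 2 * (1 + t ^ 2)).
Proof.
intros He; rewrite dist2_lt by easy; cbn [to_circle pole fst snd].
assert (Ht := one_plus_sqr_pos t).
replace (((1 - t ^ 2) / (1 + t ^ 2) - -1) ^ 2 + (2 * t / (1 + t ^ 2) - 0) ^ 2)
  with (4 / (1 + t ^ 2)) by (field; lra).
now apply Rlt_div_l.
Qed.

Lemma dist2_sym p q : dist2 p q = dist2 q p.
Proof. unfold dist2; f_equal; ring. Qed.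

Lemma dist2_diag p : dist2 p p = 0.
Proof. unfold dist2; rewrite <- sqrt_0; f_equal; ring. Qed.

Lemma circle_conj_continuous_at_pole f finv eps : increasing_pair f finv ->
  0 < eps -> exists delta, 0 < delta /\
    forall q, on_circle q -> dist2 q pole < delta ->
      dist2 (circle_conj f q) pole < eps.
Proof.
intros (H1 & H2 & H3) Heps.
(* [|t| > K] forces [|f t| > 2 / eps], so the chordal distance [2 / sqrt (1 + (f t)^2)] to the pole
   is below [eps]. Distance less than [2 / (1 + K)] means [1 + t^2 > (1 + K)^2], whence
   [|t| > K]. *)
set (K := Rmax (Rabs (finv (2 / eps))) (Rabs (finv (- (2 / eps))))).
assert (HK : Rabs (finv (2 / eps)) <= K) by apply Rmax_l.
assert (HK' : Rabs (finv (- (2 / eps))) <= K) by apply Rmax_r.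
apply Rabs_le_between in HK; apply Rabs_le_between in HK'.
assert (Hd : 0 < 2 / (1 + K)) by (apply Rdiv_lt_0_compat; lra).
exists (2 / (1 + K)); split; [easy|]; intros q Hq Hqd.
destruct (circle_cases q Hq) as [->|[t ->]];
  [now rewrite circle_conj_pole, dist2_diag|].
rewrite circle_conj_to_circle.
apply dist2_to_circle_pole_lt in Hqd; [|easy].
apply dist2_to_circle_pole_lt; [easy|].
assert (Ht : K ^ 2 < t ^ 2).
{ replace ((2 / (1 + K)) ^ 2 * (1 + t ^ 2)) with (4 * (1 + t ^ 2) / (1 + K) ^ 2)
    in Hqd by (field; lra).
  apply Rlt_div_r in Hqd; nra. }
assert (HT : 0 < 2 / eps) by (apply Rdiv_lt_0_compat; lra).
assert (Hf : (2 / eps) ^ 2 < f t ^ 2).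
{ destruct (Rle_lt_dec t K) as [Hle|Hlt].
  - assert (Hlt : t < - K) by nra.
    assert (Hft : f t < f (finv (- (2 / eps)))) by (apply H3; lra).
    rewrite H1 in Hft; nra.
  - assert (Hft : f (finv (2 / eps)) < f t) by (apply H3; lra).
    rewrite H1 in Hft; nra. }
apply Rlt_le_trans with (eps ^ 2 * (1 + (2 / eps) ^ 2)).
- replace (eps ^ 2 * (1 + (2 / eps) ^ 2)) with (eps ^ 2 + 4) by (field; lra).
  generalize (pow_lt eps 2 Heps); lra.
- apply Rmult_le_compat_l; [left; now apply pow_lt | lra].
Qed.

Lemma circle_conj_continuous_at_to_circle f finv s eps : increasing_pair f finv ->
  0 < eps -> exists delta, 0 < delta /\
    forall q, on_circle q -> dist2 q (to_circle s) < delta ->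
      dist2 (circle_conj f q) (to_circle (f s)) < eps.
Proof.
intros H Heps.
(* Chordal distance is at most twice the distance of the parameters, hence [eps / 2]. *)
destruct (increasing_pair_continuous f finv s (eps / 2) H) as (d & Hd & Hc); [lra|].
set (S := 1 + s ^ 2).
assert (HS : 1 <= S) by (unfold S; generalize (pow2_ge_0 s); lra).
(* With [e = m / S], the bound [m <= 1] gives [e^2 S <= 1] and keeps [q] off the pole, while
   [m <= d] brings the parameters within [d]. *)
set (m := Rmin 1 d).
assert (Hm : 0 < m) by (apply Rmin_glb_lt; lra).
assert (Hm1 : m <= 1) by apply Rmin_l.
assert (Hmd : m <= d) by apply Rmin_r.
set (e := m / S).
assert (He : 0 < e) by (apply Rdiv_lt_0_compat; lra).
assert (HeS : e * S = m) by (unfold e; field; lra).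
exists e; split; [easy|]; intros q Hq Hqd.
destruct (circle_cases q Hq) as [->|[t ->]].
- exfalso; rewrite dist2_sym in Hqd.
  apply dist2_to_circle_pole_lt in Hqd; [|easy]; fold S in Hqd.
  replace (e ^ 2 * S) with (e * (e * S)) in Hqd by ring.
  rewrite HeS in Hqd; nra.
- rewrite circle_conj_to_circle.
  apply dist2_to_circle_lt in Hqd; [|easy]; fold S in Hqd.
  apply dist2_to_circle_lt; [easy|].
  (* [1 + t^2 <= 2 S + 2 (t - s)^2] and [e^2 S <= 1], so the hypothesis
     [4 (t - s)^2 < e^2 S (1 + t^2)] yields [(t - s)^2 < (e S)^2]. *)
  assert (Hts : (t - s) ^ 2 < m ^ 2).
  { set (A := (t - s) ^ 2) in *.
    assert (HA : 1 + t ^ 2 <= 2 * S + 2 * A)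
      by (unfold A, S; generalize (pow2_ge_0 (2 * s - t)); nra).
    assert (HA0 : 0 <= A) by apply pow2_ge_0.
    assert (He1 : e ^ 2 * S <= 1).
    { replace (e ^ 2 * S) with (e * (e * S)) by ring; rewrite HeS; nra. }
    assert (He2 : e ^ 2 * S * S = m ^ 2) by (rewrite <- HeS; ring).
    assert (He0 : 0 <= e ^ 2 * S)
      by (apply Rmult_le_pos; [apply pow2_ge_0 | lra]).
    assert (Hlt : 4 * A < e ^ 2 * S * (2 * S + 2 * A)).
    { apply Rlt_le_trans with (1 := Hqd).
      replace (e ^ 2 * ((1 + t ^ 2) * S)) with (e ^ 2 * S * (1 + t ^ 2)) by ring.
      now apply Rmult_le_compat_l. }
    nra. }
  assert (Habs : Rabs (t - s) < d).
  { apply Rlt_le_trans with (2 := Hmd).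
    rewrite <- (Rabs_pos_eq m) by lra; apply Rsqr_lt_abs_0.
    unfold Rsqr; lra. }
  apply Hc in Habs.
  assert (Hf : (f t - f s) ^ 2 < (eps / 2) ^ 2).
  { rewrite <- (pow2_abs (f t - f s)); apply Rabs_def2 in Habs.
    assert (Ha := Rabs_pos (f t - f s)).
    assert (Hb : Rabs (f t - f s) < eps / 2) by (apply Rabs_def1; lra).
    nra. }
  apply Rlt_le_trans with (eps ^ 2 * 1); [lra|].
  apply Rmult_le_compat_l; [apply pow2_ge_0|].
  generalize (pow2_ge_0 (f s)) (pow2_ge_0 (f t)); nra.
Qed.

Lemma circle_conj_continuous f finv : increasing_pair f finv ->
  continuous_on_circle (circle_conj f).
Proof.
intros H p Hp eps Heps; destruct (circle_cases p Hp) as [->|[s ->]].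
- rewrite circle_conj_pole.
  now apply (circle_conj_continuous_at_pole f finv).
- rewrite circle_conj_to_circle.
  now apply (circle_conj_continuous_at_to_circle f finv).
Qed.

Lemma circle_conj_on_circle f p : on_circle p -> on_circle (circle_conj f p).
Proof.
intros Hp; destruct (circle_cases p Hp) as [->|[t ->]].
- now rewrite circle_conj_pole.
- rewrite circle_conj_to_circle; apply to_circle_on_circle.
Qed.

Lemma circle_conj_cancel f finv p : (forall x, f (finv x) = x) ->
  on_circle p -> circle_conj f (circle_conj finv p) = p.
Proof.
intros H Hp; destruct (circle_cases p Hp) as [->|[t ->]].
- now rewrite !circle_conj_pole.
- now rewrite !circle_conj_to_circle, H.
Qed.

Lemma circle_conj_homeo f finv : increasing_pair f finv ->
  is_homeo_plus_S1 (circle_conj f) (circle_conj finv).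
Proof.
intros H; assert (Hc := circle_conj_continuous _ _ H).
assert (Hc' := circle_conj_continuous _ _ (increasing_pair_sym _ _ H)).
destruct H as (H1 & H2 & H3).
split; [|split; [|split; [|split; [|split; [|split]]]]]; auto.
- intros p; apply circle_conj_on_circle.
- intros p; apply circle_conj_on_circle.
- intros p; now apply circle_conj_cancel.
- intros p; now apply circle_conj_cancel.
- intros p q r; now apply circle_conj_orient.
Qed.

(** * The action of BS(m, n) *)

(** The target is scaled about [1/2], so that [1/2 + k] goes to [1/2 + k n]; scaling about 0 would
    send [1/2] to [n/2], an integer for even [n]. *)
Definition stretch (l : R) (m n : nat) (x : R) : R :=
  INR n * (proj_lift l (x / INR m) - 1 / 2) + 1 / 2.

Definition stretch_inv (l : R) (m n : nat) (x : R) : R :=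
  INR m * proj_lift (/ l) ((x - 1 / 2) / INR n + 1 / 2).

Section Stretch.
Variables (l : R) (m n : nat).
Hypotheses (l_pos : 0 < l) (m_pos : 0 < INR m) (n_pos : 0 < INR n).

Lemma stretch_increasing_pair : increasing_pair (stretch l m n) (stretch_inv l m n).
Proof.
split; [|split].
- intros x; unfold stretch, stretch_inv.
  replace (INR m * proj_lift (/ l) ((x - 1 / 2) / INR n + 1 / 2) / INR m)
    with (proj_lift (/ l) ((x - 1 / 2) / INR n + 1 / 2)) by (field; lra).
  rewrite proj_lift_inv' by easy; field; lra.
- intros x; unfold stretch, stretch_inv.
  replace ((INR n * (proj_lift l (x / INR m) - 1 / 2) + 1 / 2 - 1 / 2) / INR n
           + 1 / 2)
    with (proj_lift l (x / INR m)) by (field; lra).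
  rewrite proj_lift_inv by easy; field; lra.
- intros x y H; unfold stretch; apply Rplus_lt_compat_r, Rmult_lt_compat_l; [easy|].
  apply Rplus_lt_compat_r, proj_lift_increasing; [easy|].
  apply Rmult_lt_compat_r; [now apply Rinv_0_lt_compat | easy].
Qed.

Lemma stretch_shift x : stretch l m n (x + INR m) = stretch l m n x + INR n.
Proof.
unfold stretch; replace ((x + INR m) / INR m) with (x / INR m + 1) by (field; lra).
rewrite proj_lift_succ; ring.
Qed.

Lemma stretch_diff_omega : is_diff_omega_plus (stretch l m n) (stretch_inv l m n).
Proof.
destruct stretch_increasing_pair as (H1 & H2 & H3).
split; [|split; [|split; [|split]]]; auto.
- apply analytic_affine_proj_lift with l (1 / 2 - INR n / 2) (INR n) (/ INR m) 0.
  { easy. }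
  intros x; unfold stretch.
  replace (x / INR m) with (/ INR m * x + 0) by (field; lra); field.
- apply analytic_affine_proj_lift with
    (/ l) 0 (INR m) (/ INR n) (1 / 2 - 1 / 2 / INR n).
  { now apply Rinv_0_lt_compat. }
  intros x; unfold stretch_inv.
  replace ((x - 1 / 2) / INR n + 1 / 2)
    with (/ INR n * x + (1 / 2 - 1 / 2 / INR n)) by (field; lra); ring.
Qed.
End Stretch.

Lemma stretch_contracts m n x : (1 <= m)%nat -> (m < n)%nat ->
  ~ near m 0 x ->
  near n (1 / 2) (stretch (contraction_ratio (1 / (8 * INR n))) m n x).
Proof.
intros Hm Hmn Hx.
assert (Hm' : 1 <= INR m) by now apply (le_INR 1).
assert (Hn' : INR m < INR n) by now apply lt_INR.
(* Scaling by [n] turns [d] into exactly 1/8, and scaling by [m < n] turns it into less than 1/8. *)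
set (d := 1 / (8 * INR n)).
assert (Hdn : INR n * d = 1 / 8) by (unfold d; field; lra).
assert (Hd : 0 < d < 1 / 2) by nra.
set (k := (up (x / INR m) - 1)%Z).
assert (Hk : 0 <= x / INR m - IZR k < 1).
{ unfold k; rewrite minus_IZR; destruct (archimed (x / INR m)); lra. }
assert (Ex : x = (x / INR m - IZR k) * INR m + IZR k * INR m) by (field; lra).
assert (Ht : d <= x / INR m - IZR k <= 1 - d).
(* A violation at either end would put [x] within [m d < 1/8] of [k m] or of [(k + 1) m]. *)
{ split; apply Rnot_lt_le; intros Hlt; apply Hx.
  - exists k; apply Rabs_le_between; nra.
  - exists (k + 1)%Z; rewrite plus_IZR; apply Rabs_le_between; nra. }
exists k; apply proj_lift_contracts in Ht; [|easy].
unfold stretch; set (h := proj_lift _ _) in *.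
replace (INR n * (h - 1 / 2) + 1 / 2 - 1 / 2 - IZR k * INR n)
  with (INR n * (h - 1 / 2 - IZR k)) by ring.
rewrite Rabs_mult, (Rabs_pos_eq (INR n)), <- Hdn by lra.
apply Rmult_le_compat_l; [lra | easy].
Qed.

Lemma translation_increasing_pair :
  increasing_pair (fun x => x + 1) (fun x => x - 1).
Proof. repeat split; intros; lra. Qed.

Lemma translation_analytic c : real_analytic (fun x => x + c).
Proof.
apply analytic_real_analytic; intros x0.
apply analytic_at_antiderivative with (fun _ => 1); [|apply analytic_at_const].
intros x; auto_derive; [easy | ring].
Qed.

Lemma translation_diff_omega :
  is_diff_omega_plus (fun x => x + 1) (fun x => x - 1).
Proof.
destruct translation_increasing_pair as (H1 & H2 & H3).
split; [|split; [|split; [|split]]]; auto.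
- apply translation_analytic.
- apply (translation_analytic (-1)).
Qed.

Theorem theorem1p5 : forall m n : nat, (1 <= m)%nat -> (m < n)%nat ->
  (exists f finv g ginv : R -> R,
     is_diff_omega_plus f finv /\ is_diff_omega_plus g ginv /\
     embeds_BS (fun _ => True) m n f finv g ginv) /\
  (exists f finv g ginv : pt -> pt,
     is_homeo_plus_S1 f finv /\ is_homeo_plus_S1 g ginv /\
     embeds_BS on_circle m n f finv g ginv) /\
  (exists f finv g ginv : R -> R,
     is_homeo_plus_I f finv /\ is_homeo_plus_I g ginv /\
     embeds_BS unitI m n f finv g ginv).
Proof.
intros m n Hm Hmn.
assert (Hm' : 0 < INR m) by (apply lt_0_INR; lia).
assert (Hn' : 1 < INR n) by (apply (lt_INR 1); lia).
set (d := 1 / (8 * INR n)); set (l := contraction_ratio d).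
assert (Hl : 0 < l).
{ assert (Hdn : INR n * d = 1 / 8) by (unfold d; field; lra).
  apply contraction_ratio_pos; nra. }
assert (Hf := stretch_increasing_pair l m n Hl Hm' (Rlt_trans _ _ _ Rlt_0_1 Hn')).
assert (HBS : embeds_BS (fun _ => True) m n (stretch l m n) (stretch_inv l m n)
                (fun x => x + 1) (fun x => x - 1)).
{ destruct Hf as (H1 & H2 & _); apply pingpong_embeds_BS; auto.
  - now apply stretch_shift.
  - intros x; now apply stretch_contracts. }
assert (Hg := translation_increasing_pair).
split; [|split].
- exists (stretch l m n), (stretch_inv l m n), (fun x => x + 1), (fun x => x - 1).
  split; [|split; [exact translation_diff_omega | exact HBS]].
  apply stretch_diff_omega; lra.
- exists (circle_conj (stretch l m n)), (circle_conj (stretch_inv l m n)),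
    (circle_conj (fun x => x + 1)), (circle_conj (fun x => x - 1)).
  split; [now apply circle_conj_homeo | split; [now apply circle_conj_homeo|]].
  apply (embeds_BS_transfer on_circle to_circle); auto.
  + exact to_circle_on_circle.
  + exact to_circle_inj.
  + exact circle_conj_to_circle.
  + intros p Hp; destruct (circle_cases p Hp) as [->|[t ->]]; [right|left].
    * exact circle_conj_pole.
    * now exists t.
- exists (unit_conj (stretch l m n)), (unit_conj (stretch_inv l m n)),
    (unit_conj (fun x => x + 1)), (unit_conj (fun x => x - 1)).
  split; [now apply unit_conj_homeo | split; [now apply unit_conj_homeo|]].
  apply (embeds_BS_transfer unitI to_unit); auto.
  + intros x; unfold unitI; generalize (to_unit_bounds x); lra.
  + exact to_unit_inj.
  + exact unit_conj_to_unit.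
  + intros y _; destruct (unit_conj_cases y) as [Hx|[_ Hx]]; auto.
Qed.
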